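(* For any group $\Gamma$ we have $\displaystyle r(\Gamma)=-\inf_S\frac{\ln\rho(\Gamma,S)}{\ln|S|}$, where the infimum runs over all finite symmetric subsets $S\subseteq\Gamma$ with $|S|\ge 2$.
   Context: For finite symmetric $S\subseteq\Gamma$, $\rho(\Gamma,S)$ is the operator norm on $\ell^2(\Gamma)$ of the Markov operator $M_S=\frac1{|S|}\mathbf{1}_S$ acting by left convolution. $r(\Gamma)=-\liminf_S\frac{\ln\rho(\Gamma,S)}{\ln|S|}$, the liminf over the directed set of finite symmetric subsets ordered by inclusion ($\liminf_Sf(S)=\sup_S\inf_{S'\supseteq S}f(S')$). *)

(* Defs.v *)
From HB Require Import structures.
From mathcomp Require Import all_boot all_order all_algebra.
From mathcomp Require Import monoid finmap.
From mathcomp Require Import all_classical all_reals all_analysis.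

Set Implicit Arguments.
Unset Strict Implicit.
Unset Printing Implicit Defensive.

Import Order.TTheory GRing.Theory Num.Theory.
Local Open Scope classical_set_scope.
Local Open Scope ring_scope.
Local Open Scope fset_scope.

Section Spectral.
Variables (R : realType) (G : groupType).

Definition symmetric_fset (S : {fset G}) : Prop :=
  forall s, s \in S -> (s^-1)%g \in S.

Definition l2sq (f : G -> R) : \bar R := \esum_(x in [set: G]) ((f x) ^+ 2)%:E.

Definition in_l2 (f : G -> R) : Prop := (l2sq f < +oo)%E.

Definition l2norm (f : G -> R) : R := Num.sqrt (fine (l2sq f)).

(* Markov operator M_S = |S|^-1 1_S acting by left convolution:
   (M_S f)(x) = |S|^-1 \sum_{s in S} f(s^-1 x) *)
Definition markov_op (S : {fset G}) (f : G -> R) : G -> R :=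
  fun x => (#|` S|%:R)^-1 * \sum_(s <- S) f ((s^-1 * x)%g).

Definition rho (S : {fset G}) : R :=
  sup [set l2norm (markov_op S f) | f in [set f | in_l2 f /\ l2norm f <= 1]].

(* finite symmetric subsets with |S| >= 2 (those where ln|S| <> 0) *)
Definition admissible (S : {fset G}) : Prop := symmetric_fset S /\ (2 <= #|` S|)%N.

Definition spec_ratio (S : {fset G}) : \bar R := (ln (rho S) / ln (#|` S|%:R))%:E.

(* r(G) = - liminf_S spec_ratio S, liminf over the directed set of (admissible)
   finite symmetric subsets ordered by inclusion *)
Definition r_exp : \bar R :=
  (- ereal_sup [set ereal_inf [set spec_ratio S' | S' in
        [set S' | admissible S' /\ {subset S <= S'}]] | S in admissible])%E.

End Spectral.

(* Main.v *)
(* The k^n words of length n over T, |T| = k, form a multiset whose convolution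
   operator has norm at most (k rho(T))^n.  Since 1 + 1/2 + ... + 1/k^n is at most
   H = 1 + n ln k, some superlevel set A = {x : x has multiplicity >= t} satisfies
   k^n <= t |A| H, and t 1_A is dominated by the multiset, so rho(A) <= rho(T)^n H,
   while |A| <= k^n.  Hence ln rho(A) / ln |A| is asymptotically at most
   ln rho(T) / ln k.  Because 1/|A| <= rho(A), adding a fixed set S to A costs only
   a constant factor in this bound, so the liminf along supersets of S is no larger
   than the ratio of any T. *)
Require Import Defs.
From HB Require Import structures.
From mathcomp Require Import all_boot all_order all_algebra.
From mathcomp Require Import monoid finmap.
From mathcomp Require Import all_classical all_reals all_analysis.
From mathcomp Require Import ring lra zify.

Import Order.TTheory GRing.Theory Num.Theory.
Local Open Scope classical_set_scope.
Local Open Scope ring_scope.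

Section Convolution.
Variables (R : realType) (G : groupType).
Implicit Types (f g : G -> R) (s : seq G) (c : R).

(** * Squared l^2 norms with values in the extended reals *)

Lemma sqr_sum_le (I : Type) (r : seq I) (F : I -> R) :
  (\sum_(i <- r) F i) ^+ 2 <= (size r)%:R * \sum_(i <- r) F i ^+ 2.
Proof.
elim: r => [|a r IH]; first by rewrite !big_nil expr0n mul0r.
rewrite !big_cons /= -natr1 sqrrD.
have cross : F a * (\sum_(i <- r) F i) *+ 2 <=
    (size r)%:R * F a ^+ 2 + \sum_(i <- r) F i ^+ 2.
  rewrite mulr_sumr -sumrMnl.
  have -> : (size r)%:R * F a ^+ 2 = \sum_(i <- r) F a ^+ 2.
    by rewrite big_const_seq count_predT iter_addr_0 mulr_natl.
  rewrite -big_split; apply: ler_sum => i _ /=.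
  by have := sqr_ge0 (F a - F i); rewrite sqrrB; lra.
by rewrite mulrDl mul1r mulrDr; lra.
Qed.

Lemma l2sq_ge0 f : (0 <= l2sq f)%E.
Proof. by apply: esum_ge0 => x _; rewrite lee_fin sqr_ge0. Qed.

Lemma le_l2sq f g : (forall x, `|f x| <= `|g x|) -> (l2sq f <= l2sq g)%E.
Proof.
move=> fg; apply: le_esum => x _.
rewrite lee_fin -[leLHS]real_normK ?num_real // -[leRHS]real_normK ?num_real //.
by rewrite lerXn2r ?nnegrE.
Qed.

Lemma le_esumZ (T : choiceType) (a : T -> \bar R) c : 0 <= c ->
  (forall x, (0 <= a x)%E) ->
  (\esum_(x in [set: T]) (c%:E * a x) <= c%:E * \esum_(x in [set: T]) a x)%E.
Proof.
move=> c0 a0; apply: ge_ereal_sup => _ [A AT <-].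
rewrite -ge0_mule_fsumr//; apply: lee_wpmul2l; first by rewrite lee_fin.
by apply: esum_ge; exists A.
Qed.

Lemma l2sqZ_le c f : (l2sq (fun x => c * f x)%R <= (c ^+ 2)%:E * l2sq f)%E.
Proof.
rewrite /l2sq; under eq_esum do rewrite exprMn EFinM.
by apply: le_esumZ => [|x]; rewrite ?lee_fin sqr_ge0.
Qed.

(** Pointwise [(f + g)^2 <= 2 f^2 + 2 g^2]. This replaces the triangle inequality; the lost constant
    disappears in the final asymptotics. *)
Lemma l2sqD_le f g :
  (l2sq (fun x => f x + g x)%R <= 2%:E * l2sq f + 2%:E * l2sq g)%E.
Proof.
have sq0 (h : G -> R) x : (0 <= (h x ^+ 2)%:E)%E by rewrite lee_fin sqr_ge0.
apply: le_trans (leeD (@le_esumZ _ (fun x => (f x ^+ 2)%:E) 2 _ _)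
                      (@le_esumZ _ (fun x => (g x ^+ 2)%:E) 2 _ _)) => //.
rewrite -esumD; last 2 first.
- by move=> x _; rewrite mule_ge0 ?lee_fin ?sqr_ge0.
- by move=> x _; rewrite mule_ge0 ?lee_fin ?sqr_ge0.
apply: le_esum => x _; rewrite -!EFinM -EFinD lee_fin.
by have := sqr_ge0 (f x - g x); rewrite sqrrB sqrrD; lra.
Qed.

Lemma l2sq_translate f (u : G) : l2sq (fun x => f (u * x)%g) = l2sq f.
Proof.
rewrite /l2sq [RHS](@reindex_esum _ _ _ [set: G] _ (fun x => (u * x)%g)) //.
split => // [x y _ _ /mulgI //|x _].
by exists (u^-1 * x)%g => //; rewrite mulVKg.
Qed.

Lemma l2sq_abs f : l2sq (fun x => `|f x|) = l2sq f.
Proof. by apply: eq_esum => x _; rewrite real_normK ?num_real. Qed.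

(** Square summability matters here: [fine] sends [+oo] to 0, so [l2norm] vanishes outside l^2. *)
Lemma l2normK f : in_l2 f -> l2sq f = (l2norm f ^+ 2)%:E.
Proof.
move=> fl2; have ffin : l2sq f \is a fin_num.
  by rewrite ge0_fin_numE ?l2sq_ge0.
by rewrite sqr_sqrtr ?fineK ?fine_ge0 ?l2sq_ge0.
Qed.

Lemma l2norm_le c f : 0 <= c -> (l2sq f <= (c ^+ 2)%:E)%E -> l2norm f <= c.
Proof.
move=> c0 fc; have ffin : l2sq f \is a fin_num.
  by rewrite ge0_fin_numE ?l2sq_ge0 ?(le_lt_trans fc) ?ltry.
rewrite -(ger0_norm c0) -sqrtr_sqr; apply: ler_wsqrtr.
by rewrite -lee_fin fineK.
Qed.

(** * Convolution by a finite multiset and its operator bounds *)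

Definition conv s f : G -> R := fun x => \sum_(u <- s) f (u^-1 * x)%g.

Lemma conv_ge0 s f : (forall x, 0 <= f x) -> forall x, 0 <= conv s f x.
Proof. by move=> f0 x; apply: sumr_ge0. Qed.

(** Cauchy-Schwarz at each point, then translation invariance of the norm. *)
Lemma l2sq_conv_le s f : (l2sq (conv s f) <= ((size s)%:R ^+ 2)%:E * l2sq f)%E.
Proof.
apply: (@le_trans _ _ (\esum_(x in [set: G]) ((size s)%:R%:E *
    \sum_(u <- s) (f (u^-1 * x)%g ^+ 2)%:E))%E).
  apply: le_esum => x _; rewrite sumEFin -EFinM lee_fin.
  exact: sqr_sum_le.
apply: le_trans (le_esumZ _ _ _ _ _) _ => //.
  by move=> x; apply: sume_ge0 => u _; rewrite lee_fin sqr_ge0.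
rewrite esum_sum; last by move=> *; rewrite lee_fin sqr_ge0.
rewrite (eq_bigr (fun=> l2sq f)) => [|u _]; last exact: l2sq_translate.
suff -> : (\sum_(u <- s) l2sq f = (size s)%:R%:E * l2sq f)%E.
  by rewrite expr2 EFinM -muleA.
elim: s => [|u s IH]; first by rewrite big_nil mul0e.
by rewrite big_cons IH -nat1r EFinD ge0_muleDl ?mul1e ?lee_fin.
Qed.

(* [c] bounds the l^2 operator norm of left convolution by the multiset [s];
   nonnegative test functions suffice because [conv] is positive. *)
Definition conv_bound s c := forall f, (forall x, 0 <= f x) -> in_l2 f ->
  (l2sq (conv s f) <= (c ^+ 2)%:E * l2sq f)%E.

Lemma conv_bound_size s : conv_bound s (size s)%:R.
Proof. by move=> f _ _; exact: l2sq_conv_le. Qed.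

Lemma in_l2_conv s f : in_l2 f -> in_l2 (conv s f).
Proof.
move=> fl2; rewrite /in_l2; apply: le_lt_trans (l2sq_conv_le s f) _.
by rewrite l2normK // -EFinM ltry.
Qed.

(** * Comparison of [conv_bound] with [rho] *)

Lemma markov_conv (S : {fset G}) f x :
  markov_op S f x = (#|` S|%:R)^-1 * conv S f x.
Proof. by []. Qed.

Lemma l2sq_markov_le (S : {fset G}) c f : (0 < #|` S|)%N ->
  conv_bound S c -> in_l2 f ->
  (l2sq (markov_op S f) <= ((c / #|` S|%:R) ^+ 2)%:E * l2sq f)%E.
Proof.
(* Passing to [|f|] makes [Sc] applicable, since [|conv S f| <= conv S |f|] pointwise. *)
move=> S0 Sc fl2; pose g x : R := `|f x|.
have gl2 : in_l2 g by rewrite /in_l2 l2sq_abs.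
apply: le_trans (l2sqZ_le _ _) _.
rewrite [c / _]mulrC exprMn [X in (_ <= X * _)%E]EFinM -[leRHS]muleA; apply: lee_wpmul2l.
  by rewrite lee_fin sqr_ge0.
rewrite -(l2sq_abs f); apply: le_trans (Sc _ _ gl2) => [|x]; last exact: normr_ge0.
apply: le_l2sq => x; rewrite [leRHS]ger0_norm ?conv_ge0 // /g.
- exact: ler_norm_sum.
- by move=> y; exact: normr_ge0.
Qed.

Lemma l2norm_markov_le (S : {fset G}) c f : (0 < #|` S|)%N -> 0 <= c ->
  conv_bound S c -> in_l2 f -> l2norm f <= 1 ->
  l2norm (markov_op S f) <= c / #|` S|%:R.
Proof.
move=> S0 c0 Sc fl2 f1; apply: l2norm_le; first by rewrite divr_ge0.
apply: le_trans (l2sq_markov_le _ _ _ S0 Sc fl2) _.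
rewrite -[leRHS]mule1; apply: lee_wpmul2l; first by rewrite lee_fin sqr_ge0.
by rewrite l2normK // lee_fin expr_le1 // sqrtr_ge0.
Qed.

Lemma l2sq0 : l2sq (fun _ : G => 0 : R) = 0%E.
Proof. by apply: esum1 => x _; rewrite expr0n. Qed.

Lemma rho_le (S : {fset G}) c : (0 < #|` S|)%N -> 0 <= c -> conv_bound S c ->
  rho R S <= c / #|` S|%:R.
Proof.
move=> S0 c0 Sc; apply: ge_sup.
  (* The zero function shows that the set under the supremum is nonempty. *)
  exists (l2norm (markov_op S (fun=> 0))); exists (fun=> 0) => //=.
  by rewrite /in_l2 /l2norm l2sq0 sqrtr0.
by move=> _ [f [fl2 f1] <-]; exact: l2norm_markov_le.
Qed.

Lemma rho_le1 (S : {fset G}) : (0 < #|` S|)%N -> rho R S <= 1.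
Proof.
move=> S0; apply: le_trans (rho_le _ _ S0 _ (conv_bound_size S)) _ => //.
by rewrite divff // pnatr_eq0 -lt0n.
Qed.

Lemma l2norm_markov_rho (S : {fset G}) f : (0 < #|` S|)%N ->
  in_l2 f -> l2norm f <= 1 -> l2norm (markov_op S f) <= rho R S.
Proof.
move=> S0 fl2 f1; apply: ub_le_sup; last by exists f.
exists ((size S)%:R / #|` S|%:R) => _ [g [gl2 g1] <-].
by apply: l2norm_markov_le => //; exact: conv_bound_size.
Qed.

Lemma rho_ge0 (S : {fset G}) : (0 < #|` S|)%N -> 0 <= rho R S.
Proof.
move=> S0; apply: le_trans (l2norm_markov_rho S (fun=> 0) S0 _ _).
- exact: sqrtr_ge0.
- by rewrite /in_l2 l2sq0.
- by rewrite /l2norm l2sq0 sqrtr0.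
Qed.

Lemma conv_bound_rho (S : {fset G}) : (0 < #|` S|)%N ->
  conv_bound S (#|` S|%:R * rho R S).
Proof.
move=> S0 f f0 fl2; have Sn0 : #|` S|%:R != 0 :> R by rewrite pnatr_eq0 -lt0n.
have := sqrtr_ge0 (fine (l2sq f)); rewrite -/(l2norm f) le_eqVlt.
(* A function of norm 0 cannot be normalised, but the trivial bound already makes its convolution
   vanish; any other [f] is rescaled to norm 1. *)
case/predU1P => [N0|N0].
  apply: le_trans (l2sq_conv_le S f) _.
  by rewrite l2normK // -N0 expr0n !mule0.
set N := l2norm f in N0.
pose g x := N^-1 * f x.
have g1 : (l2sq g <= 1)%E.
  apply: le_trans (l2sqZ_le _ _) _.
  by rewrite l2normK // -EFinM lee_fin -exprMn mulVf ?gt_eqF ?expr1n.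
have gl2 : in_l2 g by apply: le_lt_trans g1 _; exact: ltry.
have gn1 : l2norm g <= 1 by apply: l2norm_le; rewrite ?expr1n.
have -> : conv S f = fun x => (N * #|` S|%:R) * markov_op S g x.
  apply/funext => x; rewrite markov_conv mulrA mulfK // /conv mulr_sumr.
  by apply: eq_bigr => u _; rewrite /g mulVKf ?gt_eqF.
apply: le_trans (l2sqZ_le _ _) _.
rewrite (l2normK _ fl2) -/N l2normK; last first.
  have -> : markov_op S g = conv S (fun x => (#|` S|%:R)^-1 * g x).
    by apply/funext => x; rewrite /markov_op mulr_sumr.
  apply: in_l2_conv; apply: le_lt_trans (l2sqZ_le _ _) _.
  by rewrite l2normK // -EFinM ltry.
rewrite -!EFinM lee_fin -!exprMn.
have N_ge0 := ltW N0.
apply: lerXn2r; rewrite ?nnegrE ?mulr_ge0 ?rho_ge0 ?sqrtr_ge0 //.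
have := l2norm_markov_rho S g S0 gl2 gn1.
move=> /(ler_wpM2l (mulr_ge0 N_ge0 (ler0n R #|` S|))).
by have -> : #|` S|%:R * rho R S * N = N * #|` S|%:R * rho R S by ring.
Qed.

Lemma l2norm_ge f x : in_l2 f -> `|f x| <= l2norm f.
Proof.
move=> fl2; rewrite -sqrtr_sqr ler_wsqrtr // -lee_fin fineK; last first.
  by rewrite ge0_fin_numE ?l2sq_ge0.
apply: esum_ge; exists [set x]; last by rewrite fsbig_set1.
by split => //; exact: finite_set1.
Qed.

(** Test on the point mass at the identity: its image takes the value [1/|S|] at any [z] in [S].
    This makes [ln (rho R S)] meaningful and later absorbs the cost of a union. *)
Lemma rho_ge (S : {fset G}) : (0 < #|` S|)%N -> (#|` S|%:R)^-1 <= rho R S.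
Proof.
move=> S0; pose d (x : G) : R := (x == 1%g)%:R.
have d1 : l2sq d = 1%E.
  transitivity (\esum_(x in [set 1%g : G]) (1 : \bar R)%E).
    rewrite esum_mkcond; apply: eq_esum => x _; rewrite /d.
    by case: eqP => [->|/(@memNset _ [set 1%g]) ->]; rewrite ?mem_set ?expr1n ?expr0n.
  by rewrite esum_set1.
have [z zS] : exists z : G, z \in S.
  by move: S0; rewrite cardfs_gt0 => /fset0Pn.
have dl2 : in_l2 d by rewrite /in_l2 d1 ltry.
apply: le_trans (l2norm_markov_rho S d S0 dl2 _); last first.
  by rewrite /l2norm d1 sqrtr1.
apply: le_trans (l2norm_ge _ z _); last first.
  rewrite /in_l2; apply: le_lt_trans (l2sq_markov_le _ _ _ S0 (conv_bound_size S) dl2) _.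
  by rewrite d1 mule1 ltry.
rewrite markov_conv normrM ger0_norm ?invr_ge0 // ler_peMr ?invr_ge0 //.
have d0 x : 0 <= d x by rewrite /d.
rewrite ger0_norm ?conv_ge0 // /conv (big_rem z) //= mulVg /d eqxx lerDl.
exact: sumr_ge0.
Qed.

(** * Words of fixed length, as a list whose repetitions record multiplicities *)

Fixpoint words s (n : nat) : seq G :=
  if n is n'.+1 then [seq (u * w)%g | u <- s, w <- words s n'] else [:: 1%g].

Lemma size_words s n : size (words s n) = (size s ^ n)%N.
Proof. by elim: n => //= n IH; rewrite size_allpairs IH expnS. Qed.

Lemma big_wordsS (V : nmodType) s n (h : G -> V) :
  \sum_(w <- words s n.+1) h w = \sum_(u <- s) \sum_(w <- words s n) h (u * w)%g.
Proof. by rewrite /= big_allpairs_dep. Qed.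

(** Inversion reverses a word, so the last letter has to be split off as well as the first. *)
Lemma big_wordsSr (V : nmodType) s n (h : G -> V) :
  \sum_(w <- words s n.+1) h w = \sum_(u <- s) \sum_(w <- words s n) h (w * u)%g.
Proof.
elim: n h => [|n IH] h; rewrite big_wordsS.
  by apply: eq_bigr => u _; rewrite !big_seq1 mulg1 mul1g.
under eq_bigr do rewrite IH.
rewrite exchange_big; apply: eq_bigr => u _ /=.
rewrite big_wordsS; apply: eq_bigr => v _; apply: eq_bigr => w _.
by rewrite mulgA.
Qed.

Lemma big_symmetric (V : nmodType) (S : {fset G}) (h : G -> V) :
  symmetric_fset S -> \sum_(u <- S) h (u^-1)%g = \sum_(u <- S) h u.
Proof.
move=> Ssym; rewrite -(big_map (fun u : G => (u^-1)%g) xpredT h).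
apply: perm_big; apply: uniq_perm => [||x]; rewrite ?map_inj_uniq ?fset_uniq //.
  exact: invg_inj.
apply/mapP/idP => [[u uS ->]|xS]; first exact: Ssym.
by exists (x^-1)%g; rewrite ?invgK //; exact: Ssym.
Qed.

Lemma big_words_symmetric (V : nmodType) (S : {fset G}) n (h : G -> V) :
  symmetric_fset S -> \sum_(w <- words S n) h (w^-1)%g = \sum_(w <- words S n) h w.
Proof.
move=> Ssym; elim: n h => [|n IH] h; first by rewrite !big_seq1 invg1.
rewrite big_wordsS big_wordsSr.
rewrite -(big_symmetric _ _ (fun u => \sum_(w <- words S n) h (w * u)%g) Ssym).
apply: eq_bigr => u _; rewrite -(IH (fun w => h (w * u^-1)%g)).
by apply: eq_bigr => w _; rewrite invgM.
Qed.

Lemma sum_eq_count s (x : G) : (\sum_(u <- s) (u == x : nat))%R = count_mem x s.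
Proof. by elim: s => [|u s IH]; rewrite ?big_nil ?big_cons //= IH. Qed.

Lemma count_words_symmetric (S : {fset G}) n (x : G) : symmetric_fset S ->
  count_mem (x^-1)%g (words S n) = count_mem x (words S n).
Proof.
move=> Ssym; rewrite -!sum_eq_count -(big_words_symmetric _ _ _ _ Ssym).
by apply: eq_bigr => w _; rewrite eqg_inv.
Qed.

Lemma conv_wordsS s n f : conv (words s n.+1) f = conv s (conv (words s n) f).
Proof.
apply/funext => x; rewrite /conv big_wordsS.
by apply: eq_bigr => u _; apply: eq_bigr => w _; rewrite invgM mulgA.
Qed.

Lemma conv_bound_words s c n : conv_bound s c -> conv_bound (words s n) (c ^+ n).
Proof.
move=> sc; elim: n => [|n IH] f f0 fl2.
  rewrite expr0 expr1n mul1e; apply: le_l2sq => x.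
  by rewrite /conv big_seq1 invg1 mul1g.
rewrite conv_wordsS.
apply: le_trans (sc _ (conv_ge0 _ _ f0) (in_l2_conv _ _ fl2)) _.
rewrite [c ^+ n.+1]exprS exprMn [X in (_ <= X * _)%E]EFinM -[leRHS]muleA.
by apply: lee_wpmul2l; rewrite ?lee_fin ?sqr_ge0 ?IH.
Qed.

(** * Superlevel sets of the multiplicity function *)

Definition superlevel s (t : nat) : {fset G} :=
  [fset u in s | (t <= count_mem u s)%N]%fset.

Lemma big_superlevel (V : nmodType) s t (h : G -> V) :
  \sum_(u <- superlevel s t) h u =
  \sum_(u <- undup s | (t <= count_mem u s)%N) h u.
Proof.
rewrite -[RHS]big_filter; apply: perm_big.
apply: uniq_perm => [||x]; rewrite ?filter_uniq ?undup_uniq //.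
by rewrite mem_filter mem_undup /superlevel !inE andbC.
Qed.

Lemma big_undup_count (V : nmodType) s (h : G -> V) :
  \sum_(u <- undup s) h u *+ count_mem u s = \sum_(u <- s) h u.
Proof. by rewrite -[RHS]big_undup_iterop_count. Qed.

(** On the superlevel set the multiplicity is at least [t], so [t] times its indicator is below the
    multiplicity function; on nonnegative [f] the convolutions compare pointwise. *)
Lemma conv_bound_superlevel s t c : (0 < t)%N -> conv_bound s c ->
  conv_bound (superlevel s t) (c / t%:R).
Proof.
move=> t0 sc f f0 fl2; have tR : 0 < t%:R :> R by rewrite ltr0n.
apply: (@le_trans _ _ (l2sq (fun x => t%:R^-1 * conv s f x))).
  apply: le_l2sq => x.
  rewrite !ger0_norm ?mulr_ge0 ?invr_ge0 ?conv_ge0 // ler_pdivlMl //.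
  rewrite /conv big_superlevel -big_undup_count mulr_sumr big_mkcond.
  apply: ler_sum => u _; case: ifP => [tu|_]; last by rewrite mulrn_wge0.
  by rewrite mulr_natl ler_wpMn2l.
apply: le_trans (l2sqZ_le _ _) _.
rewrite [c / _]mulrC exprMn [X in (_ <= X * _)%E]EFinM -[leRHS]muleA.
by apply: lee_wpmul2l; rewrite ?lee_fin ?sqr_ge0 ?sc.
Qed.

Lemma card_superlevel s t :
  #|` superlevel s t| = (\sum_(u <- undup s) ((t <= count_mem u s)%N : nat))%R.
Proof.
rewrite -sum1_size (big_superlevel _ _ _ (fun=> 1%N)) big_mkcond.
by apply: eq_bigr => u _; case: leqP.
Qed.

Lemma sum_leq_minn (m M : nat) :
  \sum_(1 <= t < M.+1) ((t <= m)%N : nat) = minn m M.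
Proof.
elim: M => [|M IH]; first by rewrite big_geq // minn0.
by rewrite big_nat_recr //= IH; lia.
Qed.

(** Layer-cake summation: [u] is counted once for each [t] up to its multiplicity, which never
    exceeds [size s]. *)
Lemma sum_card_superlevel s :
  \sum_(1 <= t < (size s).+1) #|` superlevel s t| = size s.
Proof.
under eq_bigr do rewrite card_superlevel.
rewrite exchange_big /= -[RHS]sum1_size -[RHS](big_undup_count _ s (fun=> 1%N)).
apply: eq_bigr => u _; rewrite sum_leq_minn -[RHS]mulr_natr mul1r natn.
by apply/minn_idPl; exact: count_size.
Qed.

Lemma harmonic_le (M : nat) : (0 < M)%N ->
  \sum_(1 <= t < M.+1) (t%:R : R)^-1 <= 1 + ln M%:R.
Proof.
elim: M => // -[|M] IH _; first by rewrite big_nat1 invr1 ln1 addr0.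
rewrite big_nat_recr //=; apply: le_trans (lerD (IH isT) (lexx _)) _.
rewrite -addrA lerD2l -lerBrDl.
have M1 : 0 < M.+1%:R :> R by rewrite ltr0n.
have M2 : 0 < M.+2%:R :> R by rewrite ltr0n.
(* The increment of the logarithm is written so that [ln (1 + x) <= x] applies at
   [x = - 1/(M+2)]. *)
have -> : ln M.+2%:R - ln M.+1%:R = - ln (1 + - M.+2%:R^-1) :> R.
  have -> : 1 + - M.+2%:R^-1 = M.+1%:R / M.+2%:R :> R.
    have -> : M.+1%:R = M.+2%:R - 1 :> R by rewrite -[in RHS]natr1 addrK.
    by rewrite mulrBl divff ?mul1r ?gt_eqF.
  by rewrite lnM ?posrE ?invr_gt0 // lnV ?posrE //; ring.
rewrite lerNr; apply: le_ln1Dx.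
by rewrite ltrN2 invf_lt1 // ltr1n.
Qed.

(* If every superlevel set were smaller than [size s / (t H)] with
   [H = 1 + ln (size s)], then summing over [t] would contradict
   [sum_card_superlevel] and [harmonic_le]. *)
Lemma large_superlevel s : (0 < size s)%N -> exists2 t, (0 < t)%N &
  (size s)%:R <= t%:R * #|` superlevel s t|%:R * (1 + ln (size s)%:R) :> R.
Proof.
move=> s0; set M := size s in s0 *; set H : R := 1 + ln _.
have M0 : 0 < M%:R :> R by rewrite ltr0n.
have H0 : 0 < H by rewrite ltr_pwDl ?ln_ge0 ?ler1n.
apply: contrapT => /forall2NP small.
have {}small t : (0 < t)%N -> #|` superlevel s t|%:R < M%:R / H * t%:R^-1 :> R.
  move=> t0; have [//|/negP] := small t; rewrite -ltNge => lt_tM.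
  have tR : 0 < t%:R :> R by rewrite ltr0n.
  by rewrite ltr_pdivlMr // ltr_pdivlMr // [X in X * H]mulrC.
suff : M%:R < M%:R :> R by rewrite ltxx.
rewrite -[X in X%:R < _](sum_card_superlevel s) natr_sum.
apply: (@lt_le_trans _ _ (\sum_(1 <= t < M.+1) (M%:R / H * t%:R^-1))).
  apply: ltr_sum_nat => //.
  by move=> t /andP[t1 _]; exact: small.
rewrite -mulr_sumr -ler_pdivlMl ?divr_gt0 // invf_div -mulrA mulVf ?gt_eqF //.
by rewrite mulr1 harmonic_le.
Qed.

Lemma symmetric_superlevel_words (S : {fset G}) n t : symmetric_fset S ->
  symmetric_fset (superlevel (words S n) t).
Proof.
move=> Ssym x; rewrite !inE /= count_words_symmetric // => /andP[xw tx].
by rewrite tx andbT -has_pred1 has_count count_words_symmetric // -has_count has_pred1.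
Qed.

(** * Adjoining a fixed set to a large superlevel set *)

Lemma symmetric_fsetU (S A : {fset G}) : symmetric_fset S -> symmetric_fset A ->
  symmetric_fset (S `|` A)%fset.
Proof.
by move=> Ss As x; rewrite !inE => /orP[/Ss|/As] ->; rewrite ?orbT.
Qed.

(** The indicator of a union is at most the sum of the indicators. The factor 2 comes from
    [l2sqD_le], as [2 a^2 + 2 b^2 <= (2 (a + b))^2]. *)
Lemma conv_bound_fsetU (S A : {fset G}) (a b : R) : 0 <= a -> 0 <= b ->
  conv_bound S a -> conv_bound A b -> conv_bound (S `|` A)%fset (2 * (a + b)).
Proof.
move=> a0 b0 Sa Ab f f0 fl2.
apply: (@le_trans _ _ (l2sq (fun x => conv S f x + conv A f x))).
  apply: le_l2sq => x; rewrite !ger0_norm ?addr_ge0 ?conv_ge0 //.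
  rewrite /conv -big_cat -[leRHS]big_undup_count.
  rewrite (perm_big (undup (S ++ A))) /=; last first.
    apply: uniq_perm; rewrite ?undup_uniq ?fset_uniq // => u.
    by rewrite mem_undup mem_cat inE.
  rewrite !big_seq; apply: ler_sum => u; rewrite mem_undup -has_pred1 has_count.
  by move=> u_in; rewrite -[leLHS]mulr1n ler_wpMn2l.
apply: le_trans (l2sqD_le _ _) _.
apply: le_trans (leeD (lee_wpmul2l _ (Sa f f0 fl2))
                      (lee_wpmul2l _ (Ab f f0 fl2))) _ => //.
rewrite l2normK // -!EFinM -EFinD lee_fin.
have := sqr_ge0 (l2norm f); set N := _ ^+ 2 => N0.
rewrite [2 * (a ^+ 2 * N)]mulrA [2 * (b ^+ 2 * N)]mulrA -mulrDl; apply: ler_wpM2r => //.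
have := mulr_ge0 a0 b0; have := sqr_ge0 a; have := sqr_ge0 b; nra.
Qed.

Lemma card_superlevel_le s t : (#|` superlevel s t| <= size s)%N.
Proof.
apply: uniq_leq_size; first exact: fset_uniq.
by move=> u; rewrite !inE => /andP[].
Qed.

Lemma rho_amplify (S T : {fset G}) n : (0 < #|` S|)%N -> (0 < #|` T|)%N ->
  symmetric_fset S -> symmetric_fset T ->
  exists S' : {fset G}, [/\ symmetric_fset S', {subset S <= S'},
    (#|` S'| <= #|` S| + #|` T| ^ n)%N &
    rho R S' <= 2 * (#|` S|%:R + 1) *
                (rho R T ^+ n * (1 + ln (#|` T|%:R : R) *+ n))].
Proof.
move=> S0 T0 Ssym Tsym; set k := #|` T|; pose s := words T n.
have sz : size s = (k ^ n)%N by exact: size_words.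
have k0 : 0 < k%:R :> R by rewrite ltr0n.
have s0 : (0 < size s)%N by rewrite sz expn_gt0 T0.
have [t t0] := large_superlevel _ s0.
set A := superlevel s t; rewrite sz natrX lnXn // => leA.
have tR : 0 < t%:R :> R by rewrite ltr0n.
have H0 : 0 < 1 + ln (k%:R : R) *+ n.
  by rewrite ltr_pwDl // mulrn_wge0 // ln_ge0 // ler1n.
have A0 : (0 < #|` A|)%N.
  rewrite lt0n; apply/eqP => A_eq0; move: leA.
  by rewrite A_eq0 mulr0 mul0r leNgt exprn_gt0.
have AR : 0 < #|` A|%:R :> R by rewrite ltr0n.
set q := rho R T ^+ n * _.
have rT0 := rho_ge0 _ T0; have rTn0 : 0 <= rho R T ^+ n by exact: exprn_ge0.
pose a := (k%:R * rho R T) ^+ n / t%:R.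
have a0 : 0 <= a by rewrite divr_ge0 // exprn_ge0 // mulr_ge0 // ltW.
(* [leA] bounds [k^n / (t |A|)] by the logarithmic factor of [q]. *)
have aA : a / #|` A|%:R <= q.
  rewrite /a exprMn -mulrA -invfM ler_pdivrMr ?mulr_gt0 // /q.
  by have := ler_wpM2l rTn0 leA; lra.
have Ab : conv_bound A a.
  by apply: conv_bound_superlevel => //; exact/conv_bound_words/conv_bound_rho.
(* This turns the contribution [|S| / |A|] of the fixed set into at most [|S| q], whence the
   constant [2 (|S| + 1)]. *)
have Aq : #|` A|%:R^-1 <= q.
  exact: le_trans (rho_ge _ A0) (le_trans (rho_le _ _ A0 a0 Ab) aA).
have SA0 : (0 < #|` (S `|` A)%fset|)%N.
  by apply: leq_trans A0 _; rewrite fsubset_leq_card ?fsubsetUr.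
exists (S `|` A)%fset; split.
- exact/symmetric_fsetU/symmetric_superlevel_words.
- by move=> x xS; rewrite inE xS.
- rewrite (leq_trans (leq_card_fsetU _ _)) // leq_add2l -sz.
  exact: card_superlevel_le.
apply: le_trans (rho_le _ _ SA0 _ (conv_bound_fsetU _ _ _ _ (ler0n _ _) a0
  (conv_bound_size S) Ab)) _; first by rewrite mulr_ge0 // addr_ge0.
apply: (@le_trans _ _ (2 * (#|` S|%:R + a) / #|` A|%:R)).
  apply: ler_wpM2l; first by rewrite mulr_ge0 // addr_ge0.
  by rewrite lef_pV2 ?posrE ?ltr0n // ler_nat fsubset_leq_card ?fsubsetUr.
have := ler_wpM2l (ler0n R #|` S|) Aq.
by rewrite mulrDr !mulrDl; lra.
Qed.

(** * Logarithmic estimates and comparison of spectral ratios *)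

Lemma ln_le_linear (d x : R) : 0 < d -> 0 < x -> ln x <= d * x - 1 - ln d.
Proof.
move=> d0 x0; have dx0 := mulr_gt0 d0 x0.
(* Up to rearrangement, this is the tangent line to [ln] at [1/d]. *)
have : ln (1 + (d * x - 1)) <= d * x - 1 by apply: le_ln1Dx; lra.
by rewrite addrCA subrr addr0 lnM ?posrE //; lra.
Qed.

(** In [n] the right side has slope [a + e b], against [a] plus a logarithm on the left. The
    logarithm is bounded by a line using half of the surplus [e b]; the other half beats the
    constants, collected in [K]. *)
Lemma log_correction_small (a b c e : R) : 0 < b -> 0 < e -> exists n : nat,
  c + a *+ n + ln (1 + b *+ n) <= (a / b + e) * (c + b *+ n).
Proof.
move=> b0 e0; pose d := e / 2; have d0 : 0 < d by rewrite divr_gt0.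
pose K := c + d - 1 - ln d - a / b * c - e * c.
have db0 := mulr_gt0 d0 b0.
have [n Kn] : exists n : nat, K / (d * b) <= n%:R.
  by exists (Num.bound (K / (d * b))); apply: ltW; exact: unstable.ltr_bound.
exists n; move: Kn; rewrite ler_pdivrMr // /K => Kn.
have nb0 : 0 <= b *+ n by rewrite mulrn_wge0 // ltW.
have := ln_le_linear d (1 + b *+ n) d0 (ltr_pwDl ltr01 nb0).
have -> : (a / b + e) * (c + b *+ n) = a / b * c + a *+ n + e * c + e * (b *+ n).
  have -> : a *+ n = a / b * (b *+ n) by rewrite mulrnAr divfK ?gt_eqF.
  by ring.
have -> : e * (b *+ n) = d * (b *+ n) + d * (b *+ n) by rewrite /d; field.
have nE : n%:R * (d * b) = d * (b *+ n) by rewrite mulr_natl mulrnAr.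
move: Kn; rewrite nE mulrDr mulr1.
move: (ln (1 + _)) (ln d) (d * (b *+ n)) (a *+ n) (a / b * c) (e * c) => *.
lra.
Qed.

Lemma ratio_amplify (S T : {fset G}) (e : R) : 0 < e ->
  admissible S -> admissible T -> exists S' : {fset G},
  [/\ admissible S', {subset S <= S'} &
      ln (rho R S') / ln (#|` S'|%:R : R) <=
      ln (rho R T) / ln (#|` T|%:R : R) + e].
Proof.
move=> e0 [Ssym S2] [Tsym T2].
have S0 : (0 < #|` S|)%N by exact: leq_trans S2.
have T0 : (0 < #|` T|)%N by exact: leq_trans T2.
set k : R := #|` T|%:R; set a := ln (rho R T); set b := ln k.
have k1 : 1 < k by rewrite ltr1n.
have k0 : 0 < k by exact: lt_trans k1.
have b0 : 0 < b by exact: ln_gt0.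
(* One constant serves both estimates: it is the factor in the bound on [rho R S'], and
   [|S| + k^n <= C k^n]. *)
pose C : R := 2 * (#|` S|%:R + 1).
have C1 : 2 <= C by rewrite /C; have := ler0n R #|` S|; lra.
have C0 : 0 < C by lra.
have rho_gt0 (A : {fset G}) : (0 < #|` A|)%N -> 0 < rho R A.
  by move=> A0; apply: lt_le_trans (rho_ge _ A0); rewrite invr_gt0 ltr0n.
have [n n_ok] := log_correction_small a b (ln C) e b0 e0.
have [S' [S'sym SS' cardS' rhoS']] := rho_amplify S T n S0 T0 Ssym Tsym.
have S'2 : (2 <= #|` S'|)%N.
  by apply: leq_trans S2 _; apply/fsubset_leq_card/fsubsetP.
have S'0 : (0 < #|` S'|)%N by exact: leq_trans S'2.
exists S'; split; [by [] | by [] |].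
have L0 : 0 < ln (#|` S'|%:R : R) by rewrite ln_gt0 // ltr1n.
have kn1 : 1 <= k ^+ n by rewrite exprn_ege1 // ltW.
have L_le : ln (#|` S'|%:R : R) <= ln C + b *+ n.
  rewrite /b -lnXn // -lnM ?posrE ?exprn_gt0 //.
  rewrite ler_ln ?posrE ?ltr0n ?mulr_gt0 ?exprn_gt0 //.
  move: cardS'; rewrite -(ler_nat R) natrD natrX -/k => /le_trans; apply.
  have := ler_wpM2l (ler0n R #|` S|) kn1; rewrite /C mulr1.
  by move: (ler0n R #|` S|); nra.
have H0 : 0 < 1 + b *+ n by rewrite ltr_pwDl // mulrn_wge0 // ltW.
have ln_rho : ln (rho R S') <= ln C + a *+ n + ln (1 + b *+ n).
  have rTn0 : 0 < rho R T ^+ n by rewrite exprn_gt0 // rho_gt0.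
  rewrite /a -lnXn ?rho_gt0 // -addrA -lnM ?posrE // -lnM ?posrE ?mulr_gt0 //.
  by rewrite ler_ln ?posrE ?mulr_gt0 ?rho_gt0.
rewrite ler_pdivrMr //; set v := a / b + e in n_ok *.
(* [L_le] bounds [ln |S'|] only from above, which helps when [v <= 0] because multiplying by [v]
   reverses it. For [v >= 0], [rho <= 1] already makes the left side nonpositive. *)
case: (leP 0 v) => [v0|/ltW v0].
  apply: (@le_trans _ _ 0); first by rewrite ln_le0 // rho_le1.
  by rewrite mulr_ge0 // ltW.
apply: le_trans ln_rho (le_trans n_ok _).
by apply: ler_wnM2l.
Qed.

End Convolution.

Theorem theorem7p6 (R : realType) (G : groupType)
  (Gnontriv : exists x y : G, x <> y) :
  r_exp R G = (- ereal_inf [set spec_ratio R S | S in @admissible G])%E.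
Proof.
rewrite /r_exp; congr (- _)%E; apply/eqP; rewrite eq_le; apply/andP; split.
  (* For fixed [S] and [T], amplifying [T] above [S] gives a competitor in the inner infimum within
     [e] of the ratio of [T]. *)
  apply: ge_ereal_sup => _ [S Sadm <-]; apply: le_ereal_inf_tmp => _ [T Tadm <-].
  apply/lee_addgt0Pr => e e0.
  have [S' [S'adm SS' le_ratio]] := ratio_amplify R G S T e e0 Sadm Tadm.
  apply: (@le_trans _ _ (spec_ratio R S')).
    by apply: ereal_inf_lbound; exists S'.
  by rewrite /spec_ratio -EFinD lee_fin.
(* The supremum dominates the inner infimum of any one admissible [S], which runs over a subfamily.
   In the trivial group there is no such [S]: the supremum would be [-oo] and the infimum [+oo]. *)
have [S Sadm] : exists S : {fset G}, admissible S.
  have [x [y xy]] := Gnontriv; pose g := (x^-1 * y)%g.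
  exists [fset 1; g; g^-1]%g%fset; split.
    move=> s; rewrite !inE => /orP[/orP[]|] /eqP ->.
    - by rewrite invg1 eqxx.
    - by rewrite eqxx orbT.
    - by rewrite invgK eqxx orbT.
  apply: (@leq_trans #|` [fset 1; g]%g%fset|); last first.
    by rewrite fsubset_leq_card // fsubsetUl.
  rewrite cardfs2 eq_sym; case: eqP => // g1; case: xy.
  by rewrite -[y](mulVKg x) -/g g1 mulg1.
apply: le_trans (ereal_sup_ubound _); last by exists S.
by apply: ereal_inf_le_tmp => _ [S' [S'adm _] <-]; exists S'.
Qed.
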